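(* Let $G$ be a finite simple graph with $n$ vertices and $m\geq 1$ edges, where $n\geq 3$. Let $\delta$ be the minimum neighborhood degree of $G$, let $M_1=\sum_{u\in V(G)}d(u)^2$, and let $\rho$ be the spectral radius of $G$ (the largest eigenvalue of its adjacency matrix). Then \[\rho^2\geq\frac{M_1(2\delta+1)-n\delta^2-n\delta}{M_1}.\]
   Context: For a vertex $u$ of a graph $G$, $d(u)$ denotes its degree and the neighborhood degree of $u$ is the sum of the degrees of the vertices adjacent to $u$. *)

(* Defs.v *)
From HB Require Import structures.
From mathcomp Require Import all_boot all_order all_algebra.
From mathcomp Require Import reals.

Set Implicit Arguments.
Unset Strict Implicit.
Unset Printing Implicit Defensive.

Import Order.TTheory GRing.Theory Num.Theory.

Section Graph.

(* A simple graph is a symmetric irreflexive adjacency relation e on T; the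
   two conditions are hypotheses of the theorem, not of the definitions. *)
Variables (T : finType) (e : rel T).

Definition edges : {set {set T}} :=
  [set E | [exists u, exists v, e u v && (E == [set u; v])]].

Definition degree (u : T) : nat := #|[set v | e u v]|.

Definition nbr_degree (u : T) : nat := \sum_(v | e u v) degree v.

(* Starting the iterated minimum from the maximum keeps the starting value
   from affecting the result when T is nonempty. *)
Definition min_nbr_degree : nat :=
  \big[minn/(\max_(u : T) nbr_degree u)]_(u : T) nbr_degree u.

Definition M1 : nat := \sum_(u : T) degree u ^ 2.

Definition adjmx (R : realType) : 'M[R]_#|T| :=
  \matrix_(i, j) (e (enum_val i) (enum_val j))%:R%R.

End Graph.

Local Open Scope ring_scope.

(* For real symmetric A all complex eigenvalues are real, so ranging over the
   eigenvalues in R loses nothing. *)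
Definition is_largest_eigenvalue (R : realType) (k : nat) (A : 'M[R]_k)
    (rho : R) : Prop :=
  eigenvalue A rho /\ (forall a : R, eigenvalue A a -> a <= rho).

Definition is_spectral_radius (R : realType) (T : finType) (e : rel T)
    (rho : R) : Prop :=
  is_largest_eigenvalue (adjmx e R) rho.

(* Main.v *)
Require Import Defs.
From HB Require Import structures.
From mathcomp Require Import all_boot all_order all_algebra.
From mathcomp Require Import reals.
From mathcomp Require Import boolp classical_sets topology normedtype derive.
From mathcomp Require Import lra.

(** Let [A] be the adjacency matrix, [d] the degree vector and [N = d A] the
    vector of neighborhood degrees. A nonnegative maximizer [x] of [|x A|^2] on
    the unit sphere satisfies [x A^2 = s^2 x], so that [x A + s x] is an
    eigenvector of [A] for [s]; hence [s <= rho] and [|x A| <= rho |x|] for all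
    [x]. For [x = d] this reads [sum N^2 <= rho^2 M_1]. Since every [N u] is an
    integer at least [delta], [(N u - delta) (N u - delta - 1) >= 0]; summing
    over [u] and using [sum N = M_1] gives the bound. *)

Set Implicit Arguments.
Unset Strict Implicit.
Unset Printing Implicit Defensive.

Import Order.TTheory GRing.Theory Num.Theory.
Import numFieldNormedType.Exports.
Local Open Scope ring_scope.

(** * Extremal properties of [|u A|^2] on the Euclidean unit sphere *)

Section DotProduct.
Variables (R : realType) (k : nat).
Implicit Types (u v w : 'rV[R]_k) (A : 'M[R]_k).

Definition dotr u v : R := (u *m v^T) 0 0.

Lemma dotrE u v : dotr u v = \sum_i u 0 i * v 0 i.
Proof. by rewrite /dotr mxE; apply: eq_bigr => i _; rewrite mxE. Qed.

Lemma dotrC u v : dotr u v = dotr v u.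
Proof. by rewrite !dotrE; apply: eq_bigr => i _; rewrite mulrC. Qed.

Lemma dotrDl u v w : dotr (u + v) w = dotr u w + dotr v w.
Proof. by rewrite /dotr mulmxDl mxE. Qed.

Lemma dotrZl a u v : dotr (a *: u) v = a * dotr u v.
Proof. by rewrite /dotr -scalemxAl mxE. Qed.

Lemma dotrDr u v w : dotr u (v + w) = dotr u v + dotr u w.
Proof. by rewrite dotrC dotrDl !(dotrC u). Qed.

Lemma dotrZr a u v : dotr u (a *: v) = a * dotr u v.
Proof. by rewrite dotrC dotrZl dotrC. Qed.

Lemma dotr_mulmx u v A : dotr (u *m A) v = dotr u (v *m A^T).
Proof. by rewrite /dotr trmx_mul trmxK mulmxA. Qed.

Lemma dotr_ge0 u : 0 <= dotr u u.
Proof. by rewrite dotrE sumr_ge0 // => i _; rewrite -expr2 sqr_ge0. Qed.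

Lemma dotr_eq0 u : (dotr u u == 0) = (u == 0).
Proof.
apply/idP/eqP => [|->]; last by rewrite dotrE big1 // => i _; rewrite mxE mul0r.
rewrite dotrE psumr_eq0 => [/allP u0|i _]; last by rewrite -expr2 sqr_ge0.
apply/rowP => i; rewrite mxE; apply/eqP.
by have := u0 i (mem_index_enum i); rewrite /= mulf_eq0 orbb.
Qed.

Lemma continuous_dotr_mulmx A :
  continuous (fun u => dotr (u *m A) (u *m A) : R).
Proof.
(* Written as a polynomial in the coordinates of [u], the map is continuous by sums and products. *)
rewrite (_ : (fun _ => _) = fun u : 'rV[R]_k =>
    \sum_j (\sum_i u 0 i * A i j) * (\sum_i u 0 i * A i j)); last first.
  by apply/funext => u; rewrite dotrE; apply: eq_bigr => j _; rewrite !mxE.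
have lin_cont j : continuous (fun u : 'rV[R]_k => \sum_i u 0 i * A i j).
  apply: (@continuous_big R _ +%R 0); first exact: add_continuous.
  move=> i _ u; apply: continuousM; [exact: coord_continuous | exact: cst_continuous].
apply: (@continuous_big R _ +%R 0); first exact: add_continuous.
by move=> j _ u; apply: continuousM; exact: lin_cont.
Qed.

Lemma continuous_dotr : continuous (fun u => dotr u u : R).
Proof.
have := @continuous_dotr_mulmx 1%:M.
by under eq_fun do rewrite mulmx1.
Qed.

(** The sphere is the preimage of a closed point and lies in the compact cube [[-1, 1]^k]. *)
Lemma compact_unit_sphere : compact [set u | dotr u u = 1]%classic.
Proof.
apply: (@subclosed_compact _ _
  [set u : 'rV[R]_k | forall i, `[(-1 : R), 1] (u 0 i)]%classic).
- have /continuous_closedP dotr_closed := continuous_dotr.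
  exact: (dotr_closed _ (@closed_eq _ 1)).
- apply: (@rV_compact R _ (fun=> `[(-1 : R), 1]%classic)) => _.
  exact: segment_compact.
move=> u /= u1 i; rewrite in_itv /= -ler_norml -(@expr_le1 _ 2) //.
rewrite real_normK ?num_real // -u1 dotrE (bigD1 i) //= expr2 lerDl sumr_ge0 //.
by move=> j _; rewrite -expr2 sqr_ge0.
Qed.

Lemma dotr_normalize u (s := (Num.sqrt (dotr u u))^-1) :
  u != 0 -> dotr (s *: u) (s *: u) = 1.
Proof.
move=> u0; rewrite dotrZl dotrZr mulrA -expr2 exprVn sqr_sqrtr ?dotr_ge0 //.
by rewrite mulVf // dotr_eq0.
Qed.

(** The vector [u0] makes the sphere nonempty; homogeneity extends the bound from the sphere to
    every [u]. *)
Lemma dotr_mulmx_max_exists A u0 : u0 != 0 ->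
  exists2 c, dotr c c = 1 &
    forall u, dotr (u *m A) (u *m A) <= dotr (c *m A) (c *m A) * dotr u u.
Proof.
move=> u0_neq0.
have [|c] := EVT_max_rV _ compact_unit_sphere
    (continuous_subspaceT (@continuous_dotr_mulmx A)).
  by eexists; exact: dotr_normalize u0_neq0.
rewrite inE /= => c1 cmax; exists c => // u.
have [->|u_neq0] := eqVneq u 0.
  by rewrite mul0mx /dotr !mul0mx mxE mulr0.
have := cmax _ (mem_set (dotr_normalize u_neq0)).
rewrite -scalemxAl dotrZl dotrZr mulrA -expr2 exprVn sqr_sqrtr ?dotr_ge0 //.
by rewrite ler_pdivrMl ?(mulrC (dotr u u)) // lt_def dotr_eq0 u_neq0 dotr_ge0.
Qed.

(* First variation of [mu |u|^2 - |u A|^2 >= 0] at the zero [c], in the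
   direction [w = c A A^T - mu c]. *)
Lemma mulmx_tr_max A mu c :
  (forall u, dotr (u *m A) (u *m A) <= mu * dotr u u) ->
  dotr (c *m A) (c *m A) = mu * dotr c c ->
  c *m A *m A^T = mu *: c.
Proof.
move=> mu_max mu_c; apply/eqP; rewrite -subr_eq0 -dotr_eq0.
set w := _ - _; set a := dotr w w.
have cross : dotr (c *m A) (w *m A) = a + mu * dotr c w.
  rewrite -[A in w *m A]trmxK -dotr_mulmx -dotrZl -dotrDl /w.
  by rewrite subrK.
clearbody w; have a_ge0 : 0 <= a by exact: dotr_ge0.
pose g := mu * a - dotr (w *m A) (w *m A).
have g_ge0 : 0 <= g by rewrite subr_ge0 mu_max.
(* At [c + t w] the terms of order 0 in [t] cancel, and [cross] reduces the linear ones to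
   [2 t a]. *)
have variation t : t * (2 * a) <= t * (t * g).
  have := mu_max (c + t *: w).
  rewrite mulmxDl -scalemxAl !(dotrDl, dotrDr, dotrZl, dotrZr) mu_c.
  rewrite (dotrC (w *m A)) cross (dotrC w c) -/a /g; lra.
have [//|a_neq0] := eqVneq a 0.
have a_gt0 : 0 < a by rewrite lt_def a_neq0.
have g1_gt0 : 0 < g + 1 by rewrite ltr_wpDl.
(* This small positive [t] would give [2 a <= a g / (g + 1) < a]; the shift by 1 covers [g = 0]. *)
have := variation (a / (g + 1)); rewrite ler_pM2l ?divr_gt0 //.
rewrite mulrAC ler_pdivlMr //; nra.
Qed.

(** By the triangle inequality in each coordinate; hence a maximizer may be taken nonnegative. *)
Lemma dotr_mulmx_norm A u (v := \row_i `|u 0 i|) : (forall i j, 0 <= A i j) ->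
  dotr (u *m A) (u *m A) <= dotr (v *m A) (v *m A).
Proof.
move=> A_ge0; rewrite !dotrE; apply: ler_sum => j _.
rewrite -!expr2 -[leLHS]real_normK ?num_real // ler_sqr ?nnegrE //.
  rewrite !mxE (le_trans (ler_norm_sum _ _ _)) // ler_sum // => i _.
  by rewrite mxE normrM (ger0_norm (A_ge0 i j)).
by rewrite mxE sumr_ge0 // => i _; rewrite mxE mulr_ge0.
Qed.

Theorem dotr_mulmx_le_largest_eigenvalue A rho u :
  A^T = A -> (forall i j, 0 <= A i j) -> is_largest_eigenvalue A rho ->
  dotr (u *m A) (u *m A) <= rho ^+ 2 * dotr u u.
Proof.
move=> A_sym A_ge0 [/eigenvalueP[v0 _ v0_neq0] rho_max].
have [c0 c0_unit c0_max] := dotr_mulmx_max_exists A v0_neq0.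
set mu := dotr (c0 *m A) _ in c0_max.
have mu_ge0 : 0 <= mu by exact: dotr_ge0.
pose c : 'rV[R]_k := \row_i `|c0 0 i|.
have c_unit : dotr c c = 1.
  rewrite -c0_unit !dotrE; apply: eq_bigr => i _.
  by rewrite mxE -!expr2 real_normK ?num_real.
have c_ge0 i : 0 <= c 0 i by rewrite mxE.
have mu_c : dotr (c *m A) (c *m A) = mu * dotr c c.
  apply: le_anti; rewrite c0_max c_unit mulr1 /=.
  exact: dotr_mulmx_norm.
have := mulmx_tr_max c0_max mu_c; rewrite A_sym => cAA.
apply: le_trans (c0_max u) _; apply: ler_wpM2r; first exact: dotr_ge0.
pose s := Num.sqrt mu.
have s_ge0 : 0 <= s by exact: sqrtr_ge0.
have s2 : s ^+ 2 = mu by exact: sqr_sqrtr.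
(* For [s = 0] the candidate eigenvector [c A + s c] may vanish, but the bound is just
   [0 <= rho ^+ 2]. *)
rewrite -s2; have [->|s_neq0] := eqVneq s 0; first by rewrite expr0n sqr_ge0.
have s_eig : eigenvalue A s.
  apply/eigenvalueP; exists (c *m A + s *: c).
    rewrite mulmxDl -scalemxAl cAA scalerDr scalerA -expr2 s2.
    by rewrite addrC.
  (* Both [c A] and [s c] have nonnegative entries, so a zero sum forces [s c = 0], against
     [|c| = 1]. *)
  apply/eqP => z0; have c0z : c = 0.
    apply/rowP => i; apply: le_anti; rewrite [X in _ <= X <= _]mxE c_ge0 andbT.
    have := congr1 (fun z : 'rV_k => z 0 i) z0; rewrite !mxE => /eqP.
    rewrite paddr_eq0 ?mulf_eq0 ?(negPf s_neq0) /=.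
    - by case/andP => _ /eqP ->.
    - by rewrite sumr_ge0 // => j _; rewrite mulr_ge0 ?c_ge0.
    - by rewrite mulr_ge0.
  by move/eqP: c_unit; rewrite c0z /dotr mul0mx mxE eq_sym oner_eq0.
by have s_le := rho_max _ s_eig; rewrite ler_sqr // nnegrE // (le_trans s_ge0).
Qed.

End DotProduct.

(** * Degree sums and the integrality inequality *)

Section NeighborhoodDegrees.
Variables (T : finType) (e : rel T).

Lemma min_nbr_degree_le u : (min_nbr_degree e <= nbr_degree e u)%N.
Proof.
(* The induction works for any starting value [x] of the iterated minimum. *)
rewrite /min_nbr_degree; move: (\max_(v : T) _)%N (mem_index_enum u) => x.
elim: (index_enum T) => // v r IHr; rewrite inE big_cons geq_min.
by case/predU1P => [->|/IHr ->]; rewrite ?leqnn ?orbT.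
Qed.

Hypothesis e_sym : symmetric e.

Lemma degreeE u : degree e u = (\sum_v e u v)%N.
Proof.
rewrite /degree -sum1_card big_mkcond /=; apply: eq_bigr => v _.
by rewrite inE; case: e.
Qed.

Lemma nbr_degreeE u : nbr_degree e u = (\sum_v degree e v * e v u)%N.
Proof.
rewrite /nbr_degree big_mkcond /=; apply: eq_bigr => v _.
by rewrite e_sym; case: e; rewrite ?muln1 ?muln0.
Qed.

(** Double counting: [degree e v] is contributed once to each of the [degree e v] neighbors of
    [v]. *)
Lemma sum_nbr_degree : (\sum_u nbr_degree e u)%N = M1 e.
Proof.
under eq_bigr do rewrite nbr_degreeE.
rewrite exchange_big; apply: eq_bigr => v _.
by rewrite -big_distrr -degreeE /= expnS expn1.
Qed.

Variable R : realType.

Lemma adjmx_tr : (adjmx e R)^T = adjmx e R.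
Proof. by apply/matrixP => i j; rewrite !mxE e_sym. Qed.

Definition degree_row : 'rV[R]_#|T| := \row_i (degree e (enum_val i))%:R.

Lemma sum_enum_val (F : T -> R) :
  \sum_(i < #|T|) F (enum_val i) = \sum_u F u.
Proof. by rewrite -(big_enum_val F). Qed.

Lemma dotr_degree_row : dotr degree_row degree_row = (M1 e)%:R.
Proof.
rewrite dotrE natr_sum -sum_enum_val.
by apply: eq_bigr => i _; rewrite mxE -expr2 natrX.
Qed.

Lemma degree_row_adjmx :
  degree_row *m adjmx e R = \row_i (nbr_degree e (enum_val i))%:R.
Proof.
apply/rowP => j; rewrite !mxE nbr_degreeE natr_sum -sum_enum_val.
by apply: eq_bigr => i _; rewrite !mxE natrM.
Qed.

Lemma dotr_degree_row_adjmx (N := degree_row *m adjmx e R) :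
  dotr N N = \sum_u (nbr_degree e u)%:R ^+ 2.
Proof.
rewrite /N degree_row_adjmx dotrE -sum_enum_val.
by apply: eq_bigr => i _; rewrite mxE expr2.
Qed.

(* Equivalent to [(x - d) * (x - d - 1) >= 0]. *)
Lemma natr_sqr_ge_secant (d x : nat) : (d <= x)%N ->
  x%:R * (2 * d%:R + 1) - d%:R ^+ 2 - d%:R <= x%:R ^+ 2 :> R.
Proof.
(* Integrality enters here: either [x = d], or [x = d + y + 1] and the product is [(y + 1) * y]. *)
move=> /subnK <-; case: (x - d)%N => [|y]; rewrite natrD; first by lra.
have : 0 <= y%:R :> R by []; rewrite -(natr1 y); nra.
Qed.

Lemma sum_sqr_nbr_degree_ge (d := (min_nbr_degree e)%:R : R) :
  (M1 e)%:R * (2 * d + 1) - #|T|%:R * d ^+ 2 - #|T|%:R * d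
    <= \sum_u (nbr_degree e u)%:R ^+ 2.
Proof.
have -> : (M1 e)%:R * (2 * d + 1) - #|T|%:R * d ^+ 2 - #|T|%:R * d =
    \sum_u ((nbr_degree e u)%:R * (2 * d + 1) - d ^+ 2 - d).
  rewrite 2!sumrB -mulr_suml -natr_sum sum_nbr_degree 2!sumr_const.
  by rewrite !(mulr_natl _ #|T|).
by apply: ler_sum => u _; exact/natr_sqr_ge_secant/min_nbr_degree_le.
Qed.

End NeighborhoodDegrees.

Theorem theorem4p1 (R : realType) (T : finType) (e : rel T) (n m : nat)
    (rho : R)
    (e_sym : symmetric e) (e_irr : irreflexive e)
    (card_V : #|T| = n) (card_E : #|edges e| = m)
    (n_ge3 : (3 <= n)%N) (m_ge1 : (1 <= m)%N)
    (rhoP : is_spectral_radius e rho) :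
  rho ^+ 2 >=
    ((M1 e)%:R * (2 * (min_nbr_degree e)%:R + 1)
      - n%:R * (min_nbr_degree e)%:R ^+ 2 - n%:R * (min_nbr_degree e)%:R)
    / (M1 e)%:R.
Proof.
(* With a zero denominator the quotient is 0 by convention. *)
have [->|M1_gt0] := posnP (M1 e); first by rewrite invr0 mulr0 sqr_ge0.
rewrite ler_pdivrMr ?ltr0n // -card_V.
apply: le_trans (sum_sqr_nbr_degree_ge e_sym R) _.
rewrite -dotr_degree_row_adjmx // -dotr_degree_row.
apply: dotr_mulmx_le_largest_eigenvalue rhoP; first exact: adjmx_tr.
by move=> i j; rewrite mxE.
Qed.
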